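(* Let $G$ be a second-countable, locally compact group and let $(\pi, \mathcal{H}_\pi)$ be a $\sigma$-projective unitary representation of $G$ admitting admissible vectors. If $\Gamma$ is a discrete amenable subgroup of $G$ such that the twisted group ring $\mathbb{C}(\Gamma,\sigma)$ contains no nontrivial zero divisors, then the coherent system $$\pi(\Gamma)g = \{ \pi(\gamma)g : \gamma \in \Gamma \}$$ is linearly independent for any nonzero vector $g \in \mathcal{H}_\pi$.
   Context: Let $\mathbb{T}$ be the unit circle in $\mathbb{C}$. A 2-cocycle on $G$ (with identity $e$) is a measurable function $\sigma : G \times G \to \mathbb{T}$ with $\sigma(x,y)\sigma(xy,z) = \sigma(x,yz)\sigma(y,z)$ for all $x,y,z \in G$ and $\sigma(e,e)=1$. A $\sigma$-projective unitary representation $(\pi,\mathcal{H}_\pi)$ of $G$ on a Hilbert space $\mathcal{H}_\pi$ is a measurable map $\pi : G \to \mathcal{U}(\mathcal{H}_\pi)$ into the unitary operators such that $\pi(x)\pi(y) = \sigma(x,y)\pi(xy)$ for all $x,y \in G$, where $\sigma$ is a 2-cocycle on $G$. A vector $h \in \mathcal{H}_\pi$ is admissible if the map $V_h f(x) = \langle f, \pi(x) h\rangle$, $f \in \mathcal{H}_\pi$, $x \in G$, defines an isometry $V_h : \mathcal{H}_\pi \to L^2(G)$ ($L^2$ with respect to left Haar measure). A countable discrete group $\Gamma$ is amenable if it admits a (left) Følner sequence, i.e. a sequence $(F_n)_{n\in\mathbb{N}}$ of finite nonempty subsets of $\Gamma$ with $\lim_{n\to\infty} |F_n \triangle \gamma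 F_n|/|F_n| = 0$ for all $\gamma \in \Gamma$. The twisted group ring $\mathbb{C}(\Gamma,\sigma)$ is the vector space of finitely supported functions $\Gamma \to \mathbb{C}$ with the product $(a *_\sigma b)(\gamma') = \sum_{\gamma \in \Gamma} \sigma(\gamma,\gamma^{-1}\gamma') a(\gamma) b(\gamma^{-1}\gamma')$, where $\sigma$ is restricted to $\Gamma \times \Gamma$. An element $a$ is a zero divisor if there is a nonzero $b \in \mathbb{C}(\Gamma,\sigma)$ with $a *_\sigma b = 0$; it is a nontrivial zero divisor if moreover $a \neq 0$. The system $\pi(\Gamma)g$ is regarded as a family indexed by $\Gamma$: it is linearly dependent if there are distinct $\gamma_1,\dots,\gamma_n \in \Gamma$ and scalars $\alpha_1,\dots,\alpha_n \in \mathbb{C}$, not all zero, with $\sum_{k=1}^n \alpha_k \pi(\gamma_k) g = 0$; otherwise it is linearly independent. *)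

(* Defs.v *)
From HB Require Import structures.
From mathcomp Require Import all_boot all_order all_algebra.
From mathcomp Require Import finmap.
From mathcomp Require Import complex.
From mathcomp Require Import all_classical all_reals all_analysis.

Set Implicit Arguments.
Unset Strict Implicit.
Unset Printing Implicit Defensive.

Import Order.TTheory GRing.Theory Num.Theory.
Import numFieldNormedType.Exports.

Local Open Scope classical_set_scope.
Local Open Scope ring_scope.

(* The cast to [numFieldType] gives access to the canonical norm and topology
   that the library puts on every [numFieldType]. *)
Definition Cplx (R : realType) : numFieldType := R[i].

(* Norms over [Cplx R] take their values in [Cplx R] (with zero imaginary
   part); this is the same norm as an element of [R]. *)
Definition rnorm (R : realType) (V : normedZmodType (Cplx R)) (v : V) : R :=
  complex.Re `|v|.

HB.mixin Record isTopologicalGroup G & PointedTopological G & Group G := {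
  mulg_continuous : continuous (fun p : G * G => (p.1 * p.2)%g) ;
  invg_continuous : continuous (fun x : G => (x^-1)%g)
}.

(* The base point plays no role; [measurableType]s are required to be pointed. *)
#[short(type="topologicalGroupType")]
HB.structure Definition TopologicalGroup :=
  {G of PointedTopological G & Group G & isTopologicalGroup G}.

(* [inner] is linear in its first argument and conjugate-linear in the second. *)
HB.mixin Record isHilbert (R : realType) H & CompleteNormedModule (Cplx R) H := {
  inner : {dot H for @conjc R : Cplx R -> Cplx R} ;
  inner_norm : forall f : H, `|f| ^+ 2 = inner f f
}.

#[short(type="hilbertType")]
HB.structure Definition Hilbert (R : realType) :=
  {H of CompleteNormedModule (Cplx R) H & isHilbert R H}.

Notation borel T := (g_sigma_algebraType (@open T%type)).

Section HaarMeasure.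
Context {R : realType} {G : topologicalGroupType}.
Local Open Scope ereal_scope.

Definition radon_measure (mu : {measure set (borel G) -> \bar R}) : Prop :=
  [/\ forall K : set G, compact K -> mu K < +oo,
      forall A : set (borel G), measurable A ->
        mu A = ereal_inf [set mu U | U in [set U : set G | open U /\ A `<=` U]]
    & forall U : set G, open U ->
        mu U = ereal_sup [set mu K | K in [set K : set G | compact K /\ K `<=` U]]].

Definition left_haar_measure (mu : {measure set (borel G) -> \bar R}) : Prop :=
  [/\ radon_measure mu,
      mu [set: G] != 0
    & forall (x : G) (A : set (borel G)), measurable A ->
        mu [set (x * y)%g | y in (A : set G)] = mu A].

End HaarMeasure.

Section ProjectiveRepresentations.
Context {R : realType} {G : topologicalGroupType} {H : hilbertType R}.

Definition cocycle (sigma : G -> G -> Cplx R) : Prop :=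
  [/\ measurable_fun [set: borel (G * G)]
        ((fun p : G * G => sigma p.1 p.2) : borel (G * G) -> borel (Cplx R)),
      forall x y, `|sigma x y| = 1,
      forall x y z, sigma x y * sigma (x * y)%g z
                    = sigma x (y * z)%g * sigma y z
    & sigma 1%g 1%g = 1].

Definition unitary_op (u : H -> H) : Prop :=
  [/\ linear u, bijective u & forall f g, inner (u f) (u g) = inner f g].

(* Measurability refers to the Borel structure of the strong operator topology,
   i.e. the topology of pointwise convergence, on the unitary group. *)
Definition projective_rep (sigma : G -> G -> Cplx R) (pi : G -> H -> H) : Prop :=
  [/\ forall x, unitary_op (pi x),
      measurable_fun [set: borel G] (pi : borel G -> borel {ptws H -> H})
    & forall x y f, pi x (pi y f) = sigma x y *: pi (x * y)%g f].

Definition coeff (pi : G -> H -> H) (h f : H) : G -> Cplx R :=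
  fun x => inner f (pi x h).

Definition L2norm (mu : {measure set (borel G) -> \bar R}) (F : G -> Cplx R) :
    \bar R :=
  ('N[mu]_2[(fun x => (rnorm (F x))%:E)])%E.

Definition in_L2 (mu : {measure set (borel G) -> \bar R}) (F : G -> Cplx R) :
    Prop :=
  measurable_fun [set: borel G] (F : borel G -> borel (Cplx R)) /\
  (L2norm mu F < +oo)%E.

Definition admissible (mu : {measure set (borel G) -> \bar R})
    (pi : G -> H -> H) (h : H) : Prop :=
  forall f : H, in_L2 mu (coeff pi h f) /\
                L2norm mu (coeff pi h f) = (rnorm f)%:E.

End ProjectiveRepresentations.

Definition folner_amenable (R : realType) (Gamma : groupType) : Prop :=
  exists F : nat -> {fset Gamma}, (forall n, F n != fset0) /\
    forall gamma : Gamma,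
      let gF n := [fset (gamma * x)%g | x in F n]%fset in
      (fun n => #|` ((F n `\` gF n) `|` (gF n `\` F n))%fset|%:R / #|` F n|%:R : R)
        @ \oo --> (0 : R).

Section TwistedGroupRing.
Context {K : pzRingType} {Gamma : groupType} (sigma : Gamma -> Gamma -> K).

Definition finitely_supported (a : Gamma -> K) : Prop :=
  finite_set [set gamma | a gamma != 0].

Definition twisted_mul (a b : Gamma -> K) : Gamma -> K := fun gamma' =>
  \sum_(gamma \in [set: Gamma])
     sigma gamma (gamma^-1 * gamma')%g * a gamma * b (gamma^-1 * gamma')%g.

Definition zero_divisor (a : Gamma -> K) : Prop :=
  exists b : Gamma -> K,
    [/\ finitely_supported b, b <> cst 0 & twisted_mul a b = cst 0].

Definition nontrivial_zero_divisor (a : Gamma -> K) : Prop :=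
  [/\ finitely_supported a, a <> cst 0 & zero_divisor a].

End TwistedGroupRing.

Definition linearly_dependent (K : pzRingType) (V : lmodType K) (I : Type)
    (v : I -> V) : Prop :=
  exists n (i : 'I_n -> I) (alpha : 'I_n -> K),
    [/\ injective i, exists k, alpha k != 0
      & \sum_(k < n) alpha k *: v (i k) = 0].

Definition linearly_independent (K : pzRingType) (V : lmodType K) (I : Type)
    (v : I -> V) : Prop := ~ linearly_dependent v.

(* Main.v *)
Require Import Defs.
From HB Require Import structures.
From mathcomp Require Import all_boot all_order all_algebra.
From mathcomp Require Import finmap.
From mathcomp Require Import complex.
From mathcomp Require Import all_classical all_reals all_analysis.
From mathcomp Require Import measurable_realfun.
From mathcomp Require Import ring.

Set Implicit Arguments.
Unset Strict Implicit.
Unset Printing Implicit Defensive.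

Import Order.TTheory GRing.Theory Num.Theory.
Import numFieldNormedType.Exports.

Local Open Scope classical_set_scope.
Local Open Scope ring_scope.

(** Let h be admissible and put C x = <g, pi x h>.  Suppose that
    sum_k alpha_k pi(gamma_k) g = 0, and let a be the element of the twisted
    group ring with coefficients alpha_k at gamma_k.  A nonzero finitely
    supported b with a * b = 0 is produced in three steps.

    Pairing the relation with pi x h and using the cocycle identity shows that,
    for every point y of G, the function x |-> C (x y) / sigma x y on Gamma is
    annihilated by a ([twisted_coeff_relation]).  These functions need not be
    finitely supported, and they have to be truncated.

    Since V_h is isometric, |C|^2 has a finite nonzero integral.  Integrating
    over an open set that carries a part of this integral and has pairwise
    disjoint Gamma-translates yields a constant c > 0 such that every finite
    subset S of Gamma admits a point x0 with
    c * sum_(s in S) |C (s x0)|^2 < |C x0|^2 ([exists_dominating_point]).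
    It matters that c does not depend on S: S is chosen below in terms of a
    set whose size is governed by c.

    Let F be a Foelner set.  With S = F F^-1, and with y = t^-1 x0 for t in F,
    the functions above give an F x F matrix whose entry at (t, t) is, up to a
    phase, C x0, and each diagonal entry carries at least a fraction c of the
    square norm of its row.  Such a matrix has rank at least c |F|
    ([rank_ge_dominant_diagonal]).  If a annihilates a function, its product
    with the restriction of that function to F vanishes off the boundary of F,
    which has fewer than c |F| elements when F is sufficiently invariant.  Hence
    some nonzero combination of the truncated rows is annihilated by a
    ([exists_finite_kernel]).  This is Elek's dimension count for zero divisors
    over amenable groups, with von Neumann dimension replaced by the rank
    estimate. *)

(** * A rank estimate *)

(** The orthogonal projection onto the row space of A has trace \rank A, and by
    Cauchy-Schwarz its i-th diagonal entry, the square norm of the projection of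
    the i-th basis vector, is at least |A i i|^2 divided by the square norm of
    the i-th row. *)
Lemma rank_ge_dominant_diagonal (C : numClosedFieldType) n (A : 'M[C]_n)
    (c : C) :
    (forall i, A i i != 0) ->
    (forall i, c * (\sum_j `|A i j| ^+ 2) <= `|A i i| ^+ 2) ->
  c * n%:R <= (\rank A)%:R.
Proof.
move=> A_neq0 A_dom.
pose Q := schmidt (row_base A).
have Q_unit : Q \is unitarymx.
  by apply: schmidt_unitarymx; exact: rank_leq_col.
have /submxP[B AE] : (A <= Q)%MS.
  by rewrite (eqmx_schmidt_free (row_base_free A)) eq_row_base.
(* Q is an isometry, so B, the coordinates of the rows of A on the orthonormal
   rows of Q, has rows of the same norms. *)
have BB i : \sum_k `|B i k| ^+ 2 = \sum_j `|A i j| ^+ 2.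
  transitivity ((B *m (B ^t*)%sesqui) i i).
    by rewrite mxE; apply: eq_bigr => k _; rewrite !mxE normCK.
  transitivity ((A *m (A ^t*)%sesqui) i i).
    have AA (M : 'M[C]_n) : M = B *m Q ->
        M *m (M ^t*)%sesqui = B *m (B ^t*)%sesqui.
      move=> ->; rewrite trmx_mul map_mxM mulmxA -[B *m Q *m _]mulmxA.
      by rewrite (unitarymxP Q_unit) mulmx1.
    by rewrite (AA _ AE).
  by rewrite mxE; apply: eq_bigr => j _; rewrite !mxE normCK.
have cQ i : c <= \sum_k `|Q k i| ^+ 2.
  have N_gt0 : 0 < \sum_j `|A i j| ^+ 2.
    rewrite (bigD1 i) //= ltr_wpDr ?exprn_gt0 ?normr_gt0 //.
    by apply: sumr_ge0 => j _; rewrite exprn_ge0.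
  rewrite -(ler_pM2r N_gt0); apply: le_trans (A_dom i) _.
  pose u := row i B; pose v := ((col i Q)^t*)%sesqui.
  have -> : A i i = dotmx u v.
    transitivity ((B *m Q) i i); first by rewrite -AE.
    by rewrite dotmxE !mxE; apply: eq_bigr => k _; rewrite !mxE conjCK.
  have CS : `|dotmx u v| ^+ 2 <= dotmx u u * dotmx v v.
    exact: (CauchySchwarz (@dotmx C _) u v).1.
  apply: le_trans CS _; rewrite !dotmxE [leRHS]mulrC.
  rewrite -BB !mxE le_eqVlt; apply/orP; left; apply/eqP; congr (_ * _).
    by apply: eq_bigr => k _; rewrite !mxE normCK.
  by apply: eq_bigr => k _; rewrite !mxE conjCK normCK mulrC.
have -> : (\rank A)%:R = \sum_i \sum_k `|Q k i| ^+ 2.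
  rewrite exchange_big /= -[in LHS](card_ord (\rank A)) -sumr_const.
  apply: eq_bigr => k _.
  have /matrixP/(_ k k) := unitarymxP Q_unit.
  rewrite !mxE eqxx mulr1n => <-.
  by apply: eq_bigr => i _; rewrite !mxE normCK.
rewrite mulr_natr -[in leLHS](card_ord n) -sumr_const.
by apply: ler_sum => i _.
Qed.

(** * Finitely supported elements of the kernel over an almost invariant set *)

Section FiniteTruncation.
Context {Gamma : groupType} {K : numClosedFieldType}.
Context (tau : Gamma -> Gamma -> K) (m : nat).
Context (alpha : 'I_m -> K) (gamma : 'I_m -> Gamma).

(** The twisted product by the element with coefficients [alpha k] at
    [gamma k], written as a sum over k so that it also applies to functions of
    infinite support. *)
Definition convolve (b : Gamma -> K) (x : Gamma) : K :=
  \sum_k tau (gamma k) ((gamma k)^-1 * x)%g * alpha k * b ((gamma k)^-1 * x)%g.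

Lemma convolve_local (b b' : Gamma -> K) (x : Gamma) :
    (forall k, b ((gamma k)^-1 * x)%g = b' ((gamma k)^-1 * x)%g) ->
  convolve b x = convolve b' x.
Proof. by move=> bb'; apply: eq_bigr => k _; rewrite bb'. Qed.

Lemma convolve_sum n (u : 'I_n -> K) (b : 'I_n -> Gamma -> K) x :
  convolve (fun y => \sum_j u j * b j y) x = \sum_j u j * convolve (b j) x.
Proof.
rewrite /convolve; under [RHS]eq_bigr => j _ do rewrite mulr_sumr.
rewrite exchange_big; apply: eq_bigr => k _ /=.
by rewrite mulr_sumr; apply: eq_bigr => j _; rewrite mulrCA.
Qed.

Local Open Scope fset_scope.

Definition translate_fset (s : Gamma) (F : {fset Gamma}) : {fset Gamma} :=
  [fset (s * x)%g | x in F].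

Lemma in_translate_fset s F x :
  (x \in translate_fset s F) = ((s^-1 * x)%g \in F).
Proof.
apply/imfsetP/idP => [[y /= yF ->]|xF]; first by rewrite mulKg.
by exists (s^-1 * x)%g => //; rewrite mulVKg.
Qed.

Definition fset_symdiff (A B : {fset Gamma}) : {fset Gamma} :=
  (A `\` B) `|` (B `\` A).

(** Off this set, membership of [(gamma k)^-1 * x] in F does not depend on k and
    agrees with membership of x. *)
Definition folner_boundary (F : {fset Gamma}) : {fset Gamma} :=
  \big[fsetU/fset0]_(k < m) fset_symdiff F (translate_fset (gamma k) F).

Lemma card_folner_boundary (F : {fset Gamma}) :
  (#|` folner_boundary F|
    <= \sum_(k < m) #|` fset_symdiff F (translate_fset (gamma k) F)|)%N.
Proof.
rewrite /folner_boundary; elim/big_ind2: _ => [|A a B b Aa Bb|//].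
  by rewrite cardfs0.
exact: leq_trans (leq_card_fsetU _ _) (leq_add Aa Bb).
Qed.

Lemma notin_folner_boundary (F : {fset Gamma}) x k :
  x \notin folner_boundary F -> ((gamma k)^-1 * x)%g \in F = (x \in F).
Proof.
move=> xB; apply/idP/idP => [sF|xF]; apply: contraNT xB => xF'.
  apply/bigfcupP; exists k; first by rewrite mem_index_enum.
  by rewrite !inE in_translate_fset sF xF' orbT.
apply/bigfcupP; exists k; first by rewrite mem_index_enum.
by rewrite !inE in_translate_fset xF xF'.
Qed.

(** The restrictions to F of the functions [v s] span a space of dimension at
    least c |F|.  For w in that space, extended by zero, [convolve w] vanishes
    off the boundary of F: at such a point it involves either only values
    outside F, or only values of a combination of the [v s], which is in the
    kernel.  Since the boundary has fewer than c |F| points, the map from w to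
    the values of [convolve w] on the boundary is not injective. *)
Lemma exists_finite_kernel (F : {fset Gamma}) (v : Gamma -> Gamma -> K)
    (c : K) :
    (forall s, convolve (v s) = cst 0) ->
    (forall s, s \in F -> v s s != 0) ->
    (forall s, s \in F -> c * (\sum_(x <- F) `|v s x| ^+ 2) <= `|v s s| ^+ 2) ->
    #|` folner_boundary F|%:R < c * #|` F|%:R ->
  exists b : Gamma -> K,
    [/\ forall x, x \notin F -> b x = 0, b <> cst 0 & convolve b = cst 0].
Proof.
set B := folner_boundary F; move=> v_ker v_neq0 v_dom B_small.
pose n := #|` F|; pose e (i : 'I_n) := nth 1%g F i.
have eF i : e i \in F by exact: mem_nth.
pose ext (w : 'rV[K]_n) (x : Gamma) := \sum_j w 0 j * (x == e j)%:R.
have ext_e w i : ext w (e i) = w 0 i.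
  rewrite /ext (bigD1 i) //= eqxx mulr1 big1 ?addr0 // => j ji.
  by rewrite nth_uniq ?fset_uniq // (inj_eq val_inj) eq_sym (negPf ji) mulr0.
have ext_out w x : x \notin F -> ext w x = 0.
  move=> xF; apply: big1 => j _; case: eqP => [xE|]; last by rewrite mulr0.
  by rewrite xE eF in xF.
have memF x : x \in F -> exists i, x = e i.
  move=> xF; have xn : (index x F < n)%N by rewrite index_mem.
  by exists (Ordinal xn); rewrite /e nth_index.
pose A : 'M[K]_n := \matrix_(i, j) v (e i) (e j).
pose T : 'M[K]_(n, #|` B|) :=
  \matrix_(j, l) convolve (fun x => (x == e j)%:R) (nth 1%g B l).
have TE w l : (w *m T) 0 l = convolve (ext w) (nth 1%g B l).
  by rewrite convolve_sum mxE; apply: eq_bigr => j _; rewrite mxE.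
have A_rank : c * n%:R <= (\rank A)%:R.
  apply: rank_ge_dominant_diagonal => i; rewrite mxE; first exact: v_neq0.
  apply: le_trans (v_dom _ (eF i)).
  rewrite (big_nth 1%g) big_mkord.
  by under eq_bigr => j _ do rewrite mxE.
have rankAT : (\rank (A *m T) < \rank A)%N.
  rewrite -(ltr_nat K); apply: lt_le_trans A_rank; apply: le_lt_trans B_small.
  by rewrite ler_nat rank_leq_col.
(* A row vector u killed by A *m T but not by A gives the combination u *m A of
   the restricted rows. *)
have : ~~ (kermx (A *m T) <= kermx A)%MS.
  apply: contraTN rankAT => /mxrankS; rewrite !mxrank_ker -leqNgt.
  by rewrite leq_subLR addnC -leq_subLR subKn ?rank_leq_row.
case/row_subPn => i; set u := row i _; rewrite sub_kermx => uA_neq0.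
have uAT : u *m (A *m T) = 0 by apply/sub_kermxP; exact: row_sub.
exists (ext (u *m A)); split; first exact: ext_out.
  move=> ext0; case/negP: uA_neq0; apply/eqP/rowP => j.
  by rewrite [RHS]mxE -ext_e ext0.
apply/funext => x /=.
have [xB|xB] := boolP (x \in B).
  have xn : (index x B < #|` B|)%N by rewrite index_mem.
  have := TE (u *m A) (Ordinal xn).
  by rewrite nth_index // => <-; rewrite -mulmxA uAT mxE.
have [xF|xF] := boolP (x \in F); last first.
  transitivity (convolve (cst 0) x); last by apply: big1 => k _; rewrite mulr0.
  apply: convolve_local => k.
  by rewrite ext_out // notin_folner_boundary.
transitivity (convolve (fun y => \sum_i u 0 i * v (e i) y) x).
  apply: convolve_local => k.
  have /memF[j ->] : ((gamma k)^-1 * x)%g \in F.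
    by rewrite notin_folner_boundary.
  by rewrite ext_e mxE; apply: eq_bigr => l _; rewrite [A l j]mxE.
by rewrite convolve_sum; apply: big1 => l _; rewrite v_ker mulr0.
Qed.

End FiniteTruncation.

Lemma twisted_mul_sum_delta (Gamma : groupType) (K : numClosedFieldType)
    (tau : Gamma -> Gamma -> K) m (alpha : 'I_m -> K) (gamma : 'I_m -> Gamma)
    (b : Gamma -> K) : injective gamma ->
  twisted_mul tau (fun x => \sum_k alpha k * (x == gamma k)%:R) b
    = convolve tau alpha gamma b.
Proof.
move=> gamma_inj; apply/funext => x; rewrite /twisted_mul.
have supp y : [set: Gamma] y -> y \notin [seq gamma k | k <- enum 'I_m] ->
    \sum_k alpha k * (y == gamma k)%:R = 0.
  move=> _ y_out; apply: big1 => k _.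
  have [yE|] := eqVneq y (gamma k); last by rewrite mulr0.
  by rewrite yE map_f ?mem_enum in y_out.
rewrite (@fsbigE _ _ _ _ _ [seq gamma k | k <- enum 'I_m]) //=.
- under eq_bigl => y do rewrite in_setT.
  rewrite big_map big_enum /=; apply: eq_bigr => k _.
  rewrite (bigD1 k) //= eqxx mulr1 big1 ?addr0 // => l lk.
  by rewrite (inj_eq gamma_inj) eq_sym (negPf lk) mulr0.
- by rewrite map_inj_uniq ?enum_uniq.
- by move=> y yT y_out; rewrite supp // mulr0 mul0r.
Qed.

Lemma ler_sum_subseq (R : realType) (T : eqType) (f : T -> R) (s t : seq T) :
    (forall x, 0 <= f x) -> uniq s -> uniq t -> {subset s <= t} ->
  \sum_(x <- s) f x <= \sum_(x <- t) f x.
Proof.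
move=> f_ge0 s_uniq t_uniq st.
have st_perm : perm_eq [seq x <- t | x \in s] s.
  apply: uniq_perm => //; first exact: filter_uniq.
  by move=> x; rewrite mem_filter; apply: andb_idr; exact: st.
rewrite -(perm_big _ st_perm) big_filter /= [leRHS](bigID (mem s)) /=.
by rewrite lerDl sumr_ge0.
Qed.

(** The Foelner ratios of the finitely many [gamma k] tend to 0 together, and
    their sum bounds the relative size of the boundary. *)
Lemma exists_small_boundary (R : realType) (Gamma : groupType) m
    (gamma : 'I_m -> Gamma) (c : R) :
    folner_amenable R Gamma -> 0 < c ->
  exists F : {fset Gamma},
    #|` folner_boundary gamma F|%:R < c * #|` F|%:R.
Proof.
move=> [F [F_neq0 F_lim]] c_gt0.
pose r k n : R := #|` fset_symdiff (F n) (translate_fset (gamma k) (F n))|%:R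
  / #|` F n|%:R.
have r_lim : (fun n => \sum_k r k n) @ \oo --> \sum_(k < m) (0 : R).
  apply: cvg_big => [|k _]; last exact: F_lim.
  by move=> [x y]; exact: add_continuous.
rewrite big1 // in r_lim.
have [n /= rn] := filter_ex (cvgr_lt (0 : R) r_lim c c_gt0).
exists (F n).
have Fn_gt0 : 0 < #|` F n|%:R :> R by rewrite ltr0n cardfs_gt0.
rewrite -ltr_pdivrMr //; apply: le_lt_trans rn.
rewrite -mulr_suml ler_pM2r ?invr_gt0 // -natr_sum ler_nat.
exact: card_folner_boundary.
Qed.

(** * Averaging over a discrete subgroup *)

Section Averaging.
Context {R : realType} {G : topologicalGroupType}.

Lemma continuous_mulgl (x : G) : continuous (fun y : G => (x * y)%g).
Proof.
move=> y; have pair_cvg : (fun z : G => (x, z)) z @[z --> y] --> (x, y).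
  by apply: cvg_pair; [exact: cvg_cst | exact: cvg_id].
exact: (cvg_comp _ _ pair_cvg (@mulg_continuous G (x, y))).
Qed.

Lemma measurable_fun_mulgl (x : G) :
  measurable_fun [set: borel G] ((fun y : G => (x * y)%g) : borel G -> borel G).
Proof.
apply: (@measurability _ _ (borel G) (borel G) setT _ (@open G) erefl).
move=> _ [U oU <-]; rewrite setTI.
apply: sub_sigma_algebra.
by move/continuousP: (@continuous_mulgl x); apply.
Qed.

Lemma measurable_mulgl (x : G) (A : set (borel G)) :
  measurable A ->
  measurable ([set (x * y)%g | y in (A : set G)] : set (borel G)).
Proof.
move=> mA; have -> : [set (x * y)%g | y in (A : set G)]
    = (fun y : G => (x^-1 * y)%g) @^-1` A.
  apply/seteqP; split => [_ [y Ay <-]|y Ay] /=; first by rewrite mulKg.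
  by exists (x^-1 * y)%g => //; rewrite mulVKg.
rewrite -[X in measurable X]setTI.
exact: (@measurable_fun_mulgl x^-1%g measurableT).
Qed.

Context (mu : {measure set (borel G) -> \bar R})
  (mu_invariant : forall (x : G) (A : set (borel G)), measurable A ->
     mu [set (x * y)%g | y in (A : set G)] = mu A).

Local Open Scope ereal_scope.

Lemma integral_mulgl (x : G) (A : set (borel G)) (f : G -> R) :
    measurable A -> measurable_fun [set: borel G] (f : borel G -> R) ->
    (forall y, (0 <= f y)%R) ->
  \int[mu]_(y in A) (f (x * y)%g)%:E
    = \int[mu]_(y in [set (x * y)%g | y in (A : set G)]) (f y)%:E.
Proof.
move=> mA mf f_ge0; set xA := [set (x * y)%g | y in (A : set G)].
have mxA : measurable (xA : set (borel G)) by exact: measurable_mulgl.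
pose Tx_mixin := isMeasurableFun.Build _ _ (borel G) (borel G)
  (fun y : G => (x * y)%g) (measurable_fun_mulgl x).
pose Tx : {mfun borel G >-> borel G} :=
  HB.pack (fun y : G => (x * y)%g) Tx_mixin.
transitivity (\int[pushforward mu Tx]_(y in xA) (f y)%:E).
  rewrite [RHS]ge0_integral_pushforward//.
  - congr (integral _ _ _); apply/seteqP; split => [y Ay|y [z Az]] /=.
      by exists y.
    by move/mulgI => <-.
  - apply/measurable_EFinP; exact: measurable_funS mf.
  - by move=> y _; rewrite lee_fin.
apply: (eq_measure_integral mu) => B mB _; rewrite /pushforward.
rewrite -(mu_invariant x^-1%g mB); congr (mu _).
apply/seteqP; split => [y By|_ [y By <-]] /=; last by rewrite mulVKg.
by exists (x * y)%g => //; rewrite mulKg.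
Qed.


(** If f had zero integral over each of the countably many sets, it would vanish
    almost everywhere on each of them, hence on their union. *)
Lemma exists_open_integral_gt0 (f : G -> R) (B : set (set G)) :
    measurable_fun [set: borel G] (f : borel G -> R) ->
    (forall y, (0 <= f y)%R) ->
    countable B -> B `<=` open -> (forall y, exists2 V, B V & V y) ->
    0 < \int[mu]_y (f y)%:E ->
  exists2 V, B V & 0 < \int[mu]_(y in V) (f y)%:E.
Proof.
move=> mf f_ge0 B_countable B_open B_cover f_gt0; apply: contrapT => B_null.
have mEf D : measurable_fun (D : set (borel G)) (EFin \o (f : borel G -> R)).
  by apply/measurable_EFinP; exact: measurable_funS mf.
have mV V : B V -> measurable (V : set (borel G)).
  by move=> BV; apply: sub_sigma_algebra; exact: B_open.
have ae_V V : B V -> {ae mu, forall y, V y -> (f y)%:E = 0}.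
  move=> BV; apply/(ae_eq_integral_abs mu (mV V BV) (mEf V)).
  apply/eqP; rewrite eq_le; apply/andP; split; last exact: integral_ge0.
  rewrite leNgt; apply/negP => V_gt0; apply: B_null; exists V => //.
  by under eq_integral => y _ do rewrite -[(f y)%:E]gee0_abs ?lee_fin//.
have /pfcard_geP[B0|[h]] := B_countable.
  by have [V] := B_cover 1%g; rewrite B0.
have {}ae_V : {ae mu, forall y, forall n, h n y -> (f y)%:E = 0}.
  by apply: ae_foralln => n; apply: ae_V; exact: funS.
move: f_gt0; rewrite lt_neqAle => /andP[/negP + _]; apply; apply/eqP.
rewrite -(integral0 mu setT); apply: ae_eq_integral => //.
move: ae_V; apply: (@filterS _ _ (ae_filter_ringOfSetsType mu)) => y + _.
have [V BV Vy] := B_cover y; have [n _ hn] := 'surj_h BV.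
by move=> /(_ n); rewrite hn => ->.
Qed.

Section Discrete.
Context {P : pred G} {Gamma : subGroupType P}.

Definition separated_translates (V : set G) : Prop :=
  forall (s t : Gamma) (u v : G), V u -> V v ->
    (\val s * u = \val t * v)%g -> s = t.

(** By continuity of (u, v) |-> u v^-1 at (y, y), a neighbourhood of y can be
    chosen so small that u v^-1 stays in a neighbourhood of 1 that meets Gamma
    only at 1; and s u = t v means u v^-1 = s^-1 t. *)
Lemma exists_separated_nbhs :
    [set x | P x] `<=` isolated [set x | P x] ->
  forall y : G, exists2 W, nbhs y W & separated_translates W.
Proof.
move=> P_discrete y.
have P1 : P 1%g by rewrite -(val1 Gamma); exact: valP.
have [_ [W W1 WP]] := P_discrete _ P1.
have inv_cvg : (fun p : G * G => (p.1, p.2^-1)%g) p @[p --> (y, y)]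
    --> (y, y^-1)%g.
  apply: cvg_pair; first exact: cvg_fst.
  by apply: (cvg_comp _ _ cvg_snd); exact: invg_continuous.
have := cvg_comp _ _ inv_cvg (@mulg_continuous G (y, y^-1)%g).
rewrite /= mulgV => /(_ _ W1) [[A1 A2] [/= yA1 yA2] A12].
exists (A1 `&` A2); first exact: filterI.
move=> s t u v [A1u _] [_ A2v] suv.
apply: val_inj => /=.
have : (W `&` [set x | P x]) (u * v^-1)%g.
  split; first exact: (A12 (u, v)).
  rewrite /=; have -> : (u * v^-1 = \val (s^-1 * t))%g.
    by rewrite valM gmulfV -[in LHS](mulKg (\val s) u) suv !mulgA mulgK.
  exact: valP.
rewrite WP => /= uv1.
have uv : u = v by rewrite -[u](mulgVK v) uv1 mul1g.
by move: suv; rewrite uv => /mulIg.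
Qed.

(** Let V be open with disjoint Gamma-translates and p the integral of f over V,
    p > 0.  The integral over V of the sum of the functions x |-> f (s x), s in
    S, is the integral of f over the union of the translates s V, so it is at
    most the total integral q of f.  With c = p / (2 q), the reverse inequality
    at every point of V would give p <= c q = p / 2. *)
Lemma exists_dominating_point (f : G -> R) :
    @second_countable G -> [set x | P x] `<=` isolated [set x | P x] ->
    measurable_fun [set: borel G] (f : borel G -> R) ->
    (forall y, (0 <= f y)%R) ->
    0 < \int[mu]_y (f y)%:E < +oo ->
  exists2 c : R, (0 < c)%R & forall S : seq Gamma, uniq S ->
    exists x, (c * \sum_(s <- S) f (\val s * x)%g < f x)%R.
Proof.
move=> [B B_countable [B_open B_nbhs]] P_discrete mf f_ge0 /andP[f_gt0 f_fin].
have mEf D : measurable_fun (D : set (borel G)) (EFin \o (f : borel G -> R)).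
  by apply/measurable_EFinP; exact: measurable_funS mf.
have [|||V [BV V_sep] V_gt0] := @exists_open_integral_gt0 f
    (B `&` separated_translates) mf f_ge0 _ _ _ f_gt0.
- exact: sub_countable (subset_card_le (@subIsetl _ _ _)) B_countable.
- by move=> V [/B_open].
- move=> y; have [W Wy W_sep] := exists_separated_nbhs P_discrete y.
  have [V [BV Vy] VW] := B_nbhs y W Wy.
  exists V => //; split=> // s t u v /VW Wu /VW Wv; exact: W_sep.
have mV : measurable (V : set (borel G)).
  by apply: sub_sigma_algebra; exact: B_open.
set q := \int[mu]_y _ in f_gt0 f_fin; set p := \int[mu]_(y in V) _ in V_gt0.
have pq : p <= q by apply: ge0_subset_integral => // y _; rewrite lee_fin.
have q_fin : q \is a fin_num by rewrite ge0_fin_numE // ltW.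
have p_fin : p \is a fin_num.
  by rewrite ge0_fin_numE ?ltW //; exact: le_lt_trans f_fin.
have q_gt0 : (0 < fine q)%R by rewrite fine_gt0 // f_gt0.
have p_gt0 : (0 < fine p)%R by rewrite fine_gt0 // V_gt0 (le_lt_trans pq).
pose c := (fine p / (2 * fine q))%R.
have c_gt0 : (0 < c)%R by rewrite divr_gt0 // mulr_gt0.
exists c => // S S_uniq; apply: contrapT => /forallNP S_dom.
pose sV (s : Gamma) : set (borel G) := [set (\val s * y)%g | y in V].
have msV s : measurable (sV s) by exact: measurable_mulgl.
have mfs s : measurable_fun (V : set (borel G))
    (EFin \o ((fun x => f (\val s * x)%g) : borel G -> R)).
  apply/measurable_EFinP; apply: measurable_funTS.
  exact: (measurableT_comp mf (measurable_fun_mulgl (\val s))).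
have mfS : measurable_fun (V : set (borel G))
    ((fun x => \sum_(s <- S) (f (\val s * x)%g)%:E) : borel G -> \bar R).
  by apply: emeasurable_sum => s; exact: mfs.
have : p <= c%:E * q.
  apply: (@le_trans _ _
    (\int[mu]_(x in V) (c%:E * \sum_(s <- S) (f (\val s * x)%g)%:E))).
    apply: ge0_le_integral => //.
    - by move=> y _; rewrite lee_fin.
    - exact: emeasurable_funM.
    - move=> x _; rewrite sumEFin -EFinM lee_fin leNgt.
      exact/negP/S_dom.
  rewrite ge0_integralZl_EFin ?(ltW c_gt0)//; last first.
    by move=> x _; rewrite sume_ge0 // => s _; rewrite lee_fin.
  rewrite ge0_integral_sum //; last 2 first.
  - by move=> s; exact: mfs.
  - by move=> s x _; rewrite lee_fin.
  rewrite lee_pmul2l ?lte_fin//.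
  under eq_bigr => s _ do rewrite integral_mulgl //.
  rewrite -(@ge0_integral_bigsetU _ _ _ _ _ sV (fun y => (f y)%:E)) //.
  - apply: ge0_subset_integral => //; first exact: bigsetU_measurable.
    by move=> y _; rewrite lee_fin.
  - move=> s t _ _ [_ [[u Vu <-] [v Vv]]] /esym; exact: V_sep.
  - by move=> y _; rewrite lee_fin.
rewrite -(fineK p_fin) -(fineK q_fin) -EFinM lee_fin /c.
apply/negP; rewrite -ltNge invfM !mulrA divfK ?gt_eqF //.
by rewrite ltr_pdivrMr // mulr_natr mulr2n ltrDl.
Qed.

End Discrete.
End Averaging.

(** * Square integrability of the coefficients *)

Section RealNorm.
Context {R : realType}.

Lemma rnormE (V : normedZmodType (Cplx R)) (v : V) :
  ((rnorm v)%:C%C : Cplx R) = `|v|.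
Proof. by apply: RRe_real; exact: normr_real. Qed.

Lemma rnorm_ge0 (V : normedZmodType (Cplx R)) (v : V) : 0 <= rnorm v.
Proof. by rewrite -lecR rnormE; exact: normr_ge0. Qed.

Lemma rnorm_gt0 (V : normedZmodType (Cplx R)) (v : V) :
  (0 < rnorm v) = (v != 0).
Proof. by rewrite -ltcR rnormE; exact: normr_gt0. Qed.

Lemma measurable_rnorm :
  measurable_fun [set: borel (Cplx R)]
    ((fun z : Cplx R => rnorm z) : borel (Cplx R) -> R).
Proof.
apply: (measurability _ (RGenOInfty.measurableE R)) => _ [_ [a ->] <-].
rewrite setTI; apply: sub_sigma_algebra; rewrite openE => z /=.
rewrite in_itv /= andbT -ltcR rnormE => a_lt.
apply/nbhs_ballP; exists (`|z| - a%:C%C); first by rewrite /= subr_gt0.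
move=> w /=; rewrite -ball_normE /= in_itv /= andbT -ltcR rnormE => zw.
have := le_lt_trans (lerB_dist z w) zw.
by rewrite ltrD2l ltrN2.
Qed.

Context {G : topologicalGroupType} {H : hilbertType R}.
Context (mu : {measure set (borel G) -> \bar R}).

Lemma measurable_rnorm_sqr (F : G -> Cplx R) :
    measurable_fun [set: borel G] (F : borel G -> borel (Cplx R)) ->
  measurable_fun [set: borel G]
    ((fun x => rnorm (F x) ^+ 2) : borel G -> R).
Proof.
move=> mF; apply: measurable_funX.
exact: (measurableT_comp measurable_rnorm mF).
Qed.

Lemma integral_rnorm_coeff (pi : G -> H -> H) (h f : H) :
    admissible mu pi h ->
  (\int[mu]_x (rnorm (coeff pi h f x) ^+ 2)%:E = (rnorm f ^+ 2)%:E)%E.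
Proof.
move=> /(_ f) [_ /(congr1 (fun u => poweR u 2))].
rewrite powR_Lnorm // poweR_EFin powR_mulrn ?rnorm_ge0 // => <-.
apply: eq_integral => x _.
by rewrite abse_EFin poweR_EFin ger0_norm ?powR_mulrn ?rnorm_ge0.
Qed.

End RealNorm.

(** * Coefficients of the representation and the twisted product *)

Section Intertwining.
Context {R : realType} {G : topologicalGroupType} {H : hilbertType R}.
Context (sigma : G -> G -> Cplx R) (pi : G -> H -> H).
Context (sigma_cocycle : cocycle sigma) (pi_rep : projective_rep sigma pi).

Lemma cocycle_neq0 x y : sigma x y != 0.
Proof. by have [_ s1 _ _] := sigma_cocycle; rewrite -normr_eq0 s1 oner_eq0. Qed.

Lemma coeff_mulgl (h g : H) (x y : G) :
  coeff pi h (pi x g) (x * y)%g = sigma x y * coeff pi h g y.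
Proof.
have [_ s1 _ _] := sigma_cocycle; have [unitary_pi _ piM] := pi_rep.
have [_ _ inner_pi] := unitary_pi x.
rewrite /coeff -(inner_pi g) piM linearZr_LR /= mulrA.
have -> : sigma x y * conjc (sigma x y) = 1.
  by have := normCK (sigma x y); rewrite s1 expr1n.
by rewrite mul1r.
Qed.

(** The division by [sigma x y] turns the relation between the translates of the
    coefficient, whose phases [sigma (gamma k) (z * y)] depend on y, into one
    with the phases [sigma (gamma k) z] of the twisted product. *)
Definition twisted_coeff (h g : H) (y x : G) : Cplx R :=
  coeff pi h g (x * y)%g / sigma x y.

Lemma norm_twisted_coeff (h g : H) (x y : G) :
  `|twisted_coeff h g y x| = `|coeff pi h g (x * y)%g|.
Proof.
have [_ s1 _ _] := sigma_cocycle.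
by rewrite /twisted_coeff normrM normrV ?unitfE ?cocycle_neq0 // s1 invr1 mulr1.
Qed.

(** Pair the relation with [pi (x * y) h] and, for z = (gamma k)^-1 x, replace
    [sigma (gamma k) (z * y)] by [sigma (gamma k) z * sigma x y / sigma z y];
    the factor [sigma x y] is common to all terms. *)
Lemma twisted_coeff_relation (h g : H) m (alpha : 'I_m -> Cplx R)
    (gamma : 'I_m -> G) (y x : G) :
    \sum_k alpha k *: pi (gamma k) g = 0 ->
  \sum_k sigma (gamma k) ((gamma k)^-1 * x)%g * alpha k
    * twisted_coeff h g y ((gamma k)^-1 * x)%g = 0.
Proof.
move=> rel; have [_ _ cocyc _] := sigma_cocycle.
have coeff_rel : \sum_k alpha k * coeff pi h (pi (gamma k) g) (x * y)%g = 0.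
  rewrite -[RHS](linear0l inner (pi (x * y)%g h)) -rel linear_sumlz.
  by apply: eq_bigr => k _; rewrite linearZl_LR.
apply: (mulfI (cocycle_neq0 x y)).
rewrite mulr0 mulr_sumr -[RHS]coeff_rel; apply: eq_bigr => k _.
set z := ((gamma k)^-1 * x)%g.
have xE : x = (gamma k * z)%g by rewrite mulVKg.
rewrite [in RHS]xE -mulgA coeff_mulgl.
have -> : sigma (gamma k) (z * y)%g
    = sigma (gamma k) z * sigma x y / sigma z y.
  by rewrite [in sigma x y]xE cocyc mulfK ?cocycle_neq0.
rewrite /twisted_coeff /coeff.
field.
exact: cocycle_neq0.
Qed.

End Intertwining.

(** * Linear independence *)

Theorem theorem4p1 (R : realType) (G : topologicalGroupType)
    (G_second_countable : @second_countable G)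
    (G_locally_compact : locally_compact [set: G])
    (G_hausdorff : hausdorff_space G)
    (mu : {measure set (borel G) -> \bar R}) (mu_haar : left_haar_measure mu)
    (sigma : G -> G -> Cplx R) (sigma_cocycle : cocycle sigma)
    (H : hilbertType R) (pi : G -> H -> H) (pi_rep : projective_rep sigma pi)
    (pi_admissible : exists h : H, admissible mu pi h)
    (P : pred G) (Gamma : subGroupType P)
    (Gamma_discrete : [set x | P x] `<=` isolated [set x | P x])
    (Gamma_amenable : folner_amenable R Gamma)
    (no_nontrivial_zero_divisors :
       ~ exists a : Gamma -> Cplx R,
           nontrivial_zero_divisor (fun x y => sigma (\val x) (\val y)) a)
    (g : H) (g_neq0 : g != 0) :
  linearly_independent (fun gamma : Gamma => pi (\val gamma) g).
Proof.
move=> [m [gamma [alpha [gamma_inj [k0 alpha_k0] rel]]]].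
apply: no_nontrivial_zero_divisors.
have [h h_adm] := pi_admissible; have [_ _ mu_inv] := mu_haar.
pose f x := rnorm (coeff pi h g x) ^+ 2.
have f_ge0 x : 0 <= f x by rewrite exprn_ge0 ?rnorm_ge0.
have mf : measurable_fun [set: borel G] (f : borel G -> R).
  by apply: measurable_rnorm_sqr; have [[]] := h_adm g.
have f_int : (0 < \int[mu]_x (f x)%:E < +oo)%E.
  by rewrite (integral_rnorm_coeff g h_adm) lte_fin exprn_gt0 ?rnorm_gt0 ?ltry.
have [c c_gt0 f_dom] := @exists_dominating_point R G mu mu_inv P Gamma f
  G_second_countable Gamma_discrete mf f_ge0 f_int.
have [F F_bd] := exists_small_boundary gamma Gamma_amenable c_gt0.
pose S := undup [seq (s * t^-1)%g | s <- F, t <- F].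
have [x0 x0_dom] := f_dom S (undup_uniq _).
have fx0_gt0 : 0 < f x0.
  by apply: le_lt_trans x0_dom; rewrite mulr_ge0 ?(ltW c_gt0) ?sumr_ge0.
pose tau (x y : Gamma) := sigma (\val x) (\val y).
pose v (t x : Gamma) : Cplx R :=
  twisted_coeff sigma pi h g ((\val t)^-1 * x0)%g (\val x).
have v_norm t x : `|v t x| ^+ 2 = ((f (\val (x * t^-1) * x0)%g)%:C%C : Cplx R).
  rewrite norm_twisted_coeff // -rnormE -rmorphXn /=.
  by rewrite /f valM gmulfV mulgA.
(* The row with index t starts at t^-1 x0, so that all diagonal entries have the
   modulus of the coefficient at x0, and the entry at x that of the coefficient
   at (x t^-1) x0, with x t^-1 in S. *)
have [|t tF|t tF||b [b_supp b_neq0 b_ker]] :=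
    @exists_finite_kernel Gamma (Cplx R) tau m alpha gamma F v c%:C%C.
- move=> t; apply/funext => x.
  rewrite -[RHS](twisted_coeff_relation sigma_cocycle pi_rep h
    ((\val t)^-1 * x0)%g (\val x) rel).
  by apply: eq_bigr => k _; rewrite /tau /v valM gmulfV.
- rewrite -normr_eq0 -sqrf_eq0 v_norm mulgV val1 mul1g.
  by rewrite -[0]/(0%:C%C) (inj_eq (@complexI _)) gt_eqF.
- under eq_bigr => x _ do rewrite v_norm.
  rewrite v_norm mulgV val1 mul1g -rmorph_sum -rmorphM lecR.
  apply: le_trans (ltW x0_dom); rewrite ler_pM2l //.
  rewrite -(big_map (fun x => (x * t^-1)%g) xpredT
    (fun s => f (\val s * x0)%g)).
  apply: (@ler_sum_subseq R Gamma (fun s => f (\val s * x0)%g)) => //.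
  + by rewrite map_inj_uniq ?fset_uniq //; exact: mulIg.
  + exact: undup_uniq.
  + move=> _ /mapP[x xF ->]; rewrite mem_undup.
    by apply/allpairsP; exists (x, t).
- by rewrite -!(rmorph_nat (real_complex R)) -rmorphM ltcR.
exists (fun x => \sum_k alpha k * (x == gamma k)%:R); split.
- apply: (@sub_finite_set _ _ (range gamma)); last exact: finite_image.
  move=> x /= /eqP x_supp; apply: contrapT => x_out; apply: x_supp.
  apply: big1 => k _; case: eqP => [xE|]; last by rewrite mulr0.
  by case: x_out; exists k.
- move=> /(congr1 (fun a => a (gamma k0))) /eqP.
  rewrite (bigD1 k0) //= eqxx mulr1 big1 ?addr0; first exact/negP.
  move=> k kk0; rewrite (inj_eq gamma_inj) eq_sym (negPf kk0) mulr0 //.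
exists b; split => //.
- apply: (@sub_finite_set _ _ [set` F]); last exact: finite_fset.
  move=> x /= b_x; apply: contraNT b_x => /b_supp ->; exact: eqxx.
- by rewrite twisted_mul_sum_delta.
Qed.
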